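(* Let $\mathbb{X}$ be a two-dimensional real Banach space. Then $\mathbb{X}$ is a Hilbert space if and only if the following conditions hold: (i) There exists $T \in \mathbb{L}(\mathbb{X}, \mathbb{X}^* )$ such that $\perp_T = \perp_B$. (ii) There exist $u, v \in S_\mathbb{X}$ such that $u \perp_B v$, $v \perp_B u$, $(u+v) \perp_B (u-v)$ and \[ \| (\gamma + \kappa\delta)u + (\delta - \kappa\gamma)v\| = \| (\gamma - \kappa\delta)u + (\delta + \kappa\gamma)v\| \quad\text{for all } \gamma, \delta, \kappa \in \mathbb{R}.\]
   Context: $\mathbb{X}^*$ is the dual space of $\mathbb{X}$, $\mathbb{L}(\mathbb{X},\mathbb{X}^* )$ is the set of all bounded linear operators from $\mathbb{X}$ to $\mathbb{X}^*$, and $S_{\mathbb{X}}=\{x\in\mathbb{X}:\|x\|=1\}$. For $x,y\in\mathbb{X}$, $x \perp_T y$ means $Tx(y)=0$. Birkhoff-James orthogonality: $x\perp_B y$ means $\|x+\lambda y\|\ge\|x\|$ for all scalars $\lambda\in\mathbb{R}$. $\perp_T=\perp_B$ means that for all $x,y\in\mathbb{X}$, $x\perp_T y\iff x\perp_B y$. ''$\mathbb{X}$ is a Hilbert space'' means that the norm of $\mathbb{X}$ is induced by an inner product. *)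

(* Defs.v *)
From HB Require Import structures.
From mathcomp Require Import all_boot all_order all_algebra.
From mathcomp Require Import all_classical all_reals all_analysis.

Set Implicit Arguments.
Unset Strict Implicit.
Unset Printing Implicit Defensive.

Import Order.TTheory GRing.Theory Num.Theory.
Import numFieldNormedType.Exports.
Local Open Scope classical_set_scope.
Local Open Scope ring_scope.

Definition bounded_operator (R : realType) (V W : normedModType R)
    (f : V -> W) : Prop :=
  exists M : R, forall x : V, `|f x| <= M * `|x|.

Definition bounded_functional (R : realType) (X : normedModType R) :
    pred (X -> R^o) :=
  fun f => `[< linear f /\ bounded_operator f >].

Section Dual.
Variables (R : realType) (X : normedModType R).

Fact bounded_functional_submod_closed :
  submod_closed (@bounded_functional R X).
Proof.
split.
  apply/asboolP; split; first by move=> a x y; rewrite scaler0 addr0.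
  by exists 0 => x; rewrite mul0r normr0.
move=> a f g /asboolP[lf [M fM]] /asboolP[lg [N gN]].
apply/asboolP; split.
  move=> b x y.
  change (a *: f (b *: x + y) + g (b *: x + y) =
    b *: (a *: f x + g x) + (a *: f y + g y)).
  by rewrite lf lg !scalerDr !scalerA [b * a]mulrC !addrA; congr (_ + _);
     rewrite -!addrA; congr (_ + _); rewrite addrC.
exists (`|a| * M + N) => x.
change (`|a * f x + g x| <= (`|a| * M + N) * `|x|).
rewrite mulrDl (le_trans (ler_normD _ _))// lerD ?gN// normrM -mulrA.
by rewrite ler_wpM2l ?normr_ge0// fM.
Qed.

HB.instance Definition _ :=
  GRing.isSubmodClosed.Build R (X -> R^o) (@bounded_functional R X)
    bounded_functional_submod_closed.

(* The dual space X^*: bounded linear functionals, with the pointwise vector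
   space structure (X -> R^o is an lmodType) and the operator norm. *)
Record dual := Dual {
  dual_val :> X -> R^o;
  _ : dual_val \in @bounded_functional R X }.

HB.instance Definition _ := [isSub for dual_val].
HB.instance Definition _ := [Choice of dual by <:].
HB.instance Definition _ := [SubChoice_isSubLmodule of dual by <:].

Lemma dual_linear (f : dual) : linear f.
Proof. by case: f => f /= /asboolP[]. Qed.

HB.instance Definition _ (f : dual) :=
  GRing.isLinear.Build R X R^o *:%R (dual_val f) (dual_linear f).

Lemma dual_bounded (f : dual) : bounded_operator f.
Proof. by case: f => f /= /asboolP[]. Qed.

Definition dual_norm (f : dual) : R :=
  sup [set `|f x| | x in [set x : X | `|x| <= 1]].

Let dual_norm_has_sup (f : dual) :
  has_sup [set `|f x| | x in [set x : X | `|x| <= 1]].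
Proof.
split; first by exists `|f 0|, 0 => //=; rewrite normr0.
have [M fM] := dual_bounded f.
exists `|M| => _ [x /= x1 <-]; apply: (le_trans (fM x)).
apply: (@le_trans _ _ (`|M| * `|x|)); first by rewrite ler_wpM2r ?ler_norm.
by rewrite ler_piMr.
Qed.

Let dual_norm_ub (f : dual) (x : X) : `|x| <= 1 -> `|f x| <= dual_norm f.
Proof.
move=> x1; apply: ub_le_sup; last by exists x.
by have [] := dual_norm_has_sup f.
Qed.

Let dual_norm_le (f : dual) (M : R) :
  (forall x : X, `|x| <= 1 -> `|f x| <= M) -> dual_norm f <= M.
Proof.
move=> fM; apply: ge_sup; first by have [] := dual_norm_has_sup f.
by move=> _ [x /= x1 <-]; exact: fM.
Qed.

Let dual_norm_ge0 (f : dual) : 0 <= dual_norm f.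
Proof. by rewrite (le_trans (normr_ge0 (f 0)))// dual_norm_ub// normr0. Qed.

Fact dual_normD (f g : dual) : dual_norm (f + g) <= dual_norm f + dual_norm g.
Proof.
apply: dual_norm_le => x x1; rewrite (le_trans (ler_normD _ _))//.
by rewrite lerD// dual_norm_ub.
Qed.

Let dual_normZ_le (a : R) (f : dual) :
  dual_norm (a *: f) <= `|a| * dual_norm f.
Proof.
apply: dual_norm_le => x x1; change (`|a * f x| <= `|a| * dual_norm f).
by rewrite normrM ler_wpM2l// dual_norm_ub.
Qed.

Fact dual_normZ (a : R) (f : dual) : dual_norm (a *: f) = `|a| * dual_norm f.
Proof.
apply/eqP; rewrite eq_le dual_normZ_le /=.
have [->|a0] := eqVneq a 0; first by rewrite normr0 mul0r dual_norm_ge0.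
rewrite -ler_pdivlMl ?normr_gt0// -normfV.
by have := dual_normZ_le a^-1 (a *: f); rewrite scalerA mulVf// scale1r.
Qed.

Fact dual_norm0_eq0 (f : dual) : dual_norm f = 0 -> f = 0.
Proof.
move=> f0; apply/val_inj/funext => x /=; change (f x = 0).
have [->|x0] := eqVneq x 0; first exact: linear0.
have := @dual_norm_ub f (`|x|^-1 *: x).
rewrite f0 normrZ normfV normr_id mulVf ?normr_eq0// => /(_ (lexx _)).
rewrite linearZ normr_le0 scaler_eq0 invr_eq0 normr_eq0 (negbTE x0) /=.
by move/eqP.
Qed.

HB.instance Definition _ :=
  Lmodule_isNormed.Build R dual dual_normD dual_normZ dual_norm0_eq0.

End Dual.

Definition birkhoff_james (R : realType) (X : normedModType R)
    (x y : X) : Prop :=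
  forall l : R, `|x| <= `|x + l *: y|.

Definition orth_op (R : realType) (X : normedModType R)
    (T : X -> dual X) (x y : X) : Prop :=
  T x y = 0.

(* {dot X for idfun} : symmetric, bilinear, positive definite forms on X. *)
Definition is_hilbert (R : realType) (X : normedModType R) : Prop :=
  exists ip : {dot X for idfun}, forall x : X, `|x| = Num.sqrt (ip x x).

(* Main.v *)
Require Import Defs.
From HB Require Import structures.
From mathcomp Require Import all_boot all_order all_algebra.
From mathcomp Require Import all_classical all_reals all_analysis.
From mathcomp Require Import ring lra.
Import Order.TTheory GRing.Theory Num.Theory.
Import numFieldNormedType.Exports.
Local Open Scope ring_scope.

Set Implicit Arguments.
Unset Strict Implicit.

(* If the norm comes from an inner product f, then T x := f x represents
   Birkhoff-James orthogonality and any orthonormal basis u, v satisfies (ii).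
   Conversely, in the coordinates (a, b) of a u + b v, the norm identity of (ii)
   says that the Euclidean reflection across each line through the origin
   preserves the norm. Any two points of the Euclidean unit circle are exchanged
   by such a reflection, so the norm is constant, equal to |u| = 1, on that
   circle: it is the Euclidean norm. *)

(** Trades the packed form for a bare function with equational laws. Linearity in the second
    argument follows from symmetry, and positivity from [f x x] being the square of a norm. *)
Lemma is_hilbertP (R : realType) (X : normedModType R) :
  is_hilbert X <->
  exists f : X -> X -> R,
    [/\ forall x y, f x y = f y x, forall y a x z, f (a *: x + z) y = a * f x y + f z y
      & forall x, `|x| ^+ 2 = f x x].
Proof.
split=> [[ip ipE]|[f [fC fl fn]]].
  have ipC x y : ip x y = ip y x.
    by rewrite [LHS]hermitian_subproof /= expr0 mul1r.
  exists ip; split=> // [y a x z|x].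
    by rewrite linearDl linearZl_LR.
  rewrite ipE sqr_sqrtr//.
  have [->|/neq0_dnorm_gt0/ltW//] := eqVneq x 0.
  by rewrite linear0l.
have fr y a x z : f y (a *: x + z) = a * f y x + f y z by rewrite !(fC y) fl.
have fpos u : u != 0 -> 0 < f u u by move=> u0; rewrite -fn exprn_gt0 ?normr_gt0.
have fbil : bilinear_for *%R (idfun \; *%R) f.
  by split=> y a x z; [exact: fl|exact: fr].
have fherm x y : f x y = (-1) ^+ false * idfun (f y x) by rewrite expr0 mul1r.
pose ip : {dot X for idfun} := HB.pack f
  (bilinear_isBilinear.Build R X X R *%R (idfun \; *%R) f fbil)
  (isHermitianSesquilinear.Build R X false idfun f fherm)
  (isDotProduct.Build R X f fpos).
by exists ip => x; rewrite -[ip x x]/(f x x) -fn sqrtr_sqr normr_id.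
Qed.

Section InnerProduct.
Variables (R : realType) (X : normedModType R) (f : X -> X -> R).
Hypothesis f_sym : forall x y, f x y = f y x.
Hypothesis f_linl : forall y a x z, f (a *: x + z) y = a * f x y + f z y.
Hypothesis f_norm : forall x, `|x| ^+ 2 = f x x.

Lemma ip_linr y a x z : f y (a *: x + z) = a * f y x + f y z.
Proof. by rewrite !(f_sym y) f_linl. Qed.

Lemma ip0r x : f x 0 = 0.
Proof. by have := ip_linr x (-1) 0 0; rewrite scaler0 addr0; lra. Qed.

Lemma ipZr y a x : f y (a *: x) = a * f y x.
Proof. by have := ip_linr y a x 0; rewrite ip0r !addr0. Qed.

Lemma ipZl y a x : f (a *: x) y = a * f x y.
Proof. by rewrite f_sym ipZr f_sym. Qed.

Lemma ip_normD x y (l : R) :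
  `|x + l *: y| ^+ 2 = `|x| ^+ 2 + 2 * l * f x y + l ^+ 2 * `|y| ^+ 2.
Proof. by rewrite !f_norm addrC f_linl !ip_linr [f y x]f_sym; ring. Qed.

(** Squaring the triangle inequality for [x + l *: y] with [l = 1] and [l = -1], then expanding,
    leaves the two signed bounds. *)
Lemma ip_cauchy_schwarz x y : `|f x y| <= `|x| * `|y|.
Proof.
have tri (l : R) : `|l| = 1 -> l * f x y <= `|x| * `|y|.
  move=> l1; have l2 : l ^+ 2 = 1 by rewrite -real_normK ?num_real// l1 expr1n.
  have : `|x + l *: y| ^+ 2 <= (`|x| + `|y|) ^+ 2.
    by rewrite ler_sqr ?nnegrE ?addr_ge0// (le_trans (ler_normD _ _))// normrZ l1 mul1r.
  by rewrite ip_normD l2; lra.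
have := tri 1 (normr1 _); have := tri (-1) (normrN1 _).
by rewrite ler_norml mul1r mulN1r lerNl => -> ->.
Qed.

Lemma ip_birkhoff_james x y : birkhoff_james x y <-> f x y = 0.
Proof.
split=> [xy|xy0 l]; last first.
  by rewrite -ler_sqr ?nnegrE// ip_normD xy0 mulr0 addr0 lerDl mulr_ge0// sqr_ge0.
have [->|y0] := eqVneq y 0; first exact: ip0r.
have n0 : 0 < `|y| ^+ 2 by rewrite exprn_gt0// normr_gt0.
(* This scalar minimises the quadratic [l |-> |x + l *: y| ^+ 2]; the minimum lies
   [f x y ^+ 2 / |y| ^+ 2] below [|x| ^+ 2], so [f x y] must vanish. *)
have := xy (- f x y / `|y| ^+ 2).
rewrite -ler_sqr ?nnegrE// ip_normD -addrA lerDl.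
set n := _ ^+ 2 in n0 *.
rewrite (_ : _ + _ = - (f x y ^+ 2 / n)); last by field; rewrite gt_eqF.
rewrite oppr_ge0 pmulr_lle0 ?invr_gt0// => h.
by apply/eqP; rewrite -sqrf_eq0 eq_le h sqr_ge0.
Qed.

Lemma ip_dual_subproof x : (f x : X -> R^o) \in @bounded_functional R X.
Proof.
apply/asboolP; split; first by move=> a y z; rewrite ip_linr.
by exists `|x|; exact: ip_cauchy_schwarz.
Qed.

Definition ip_dual x : dual X := Dual (ip_dual_subproof x).

Lemma ip_dual_linear : linear ip_dual.
Proof. by move=> a x y; apply/val_inj/funext => z; exact: f_linl. Qed.

Lemma ip_dual_bounded : bounded_operator ip_dual.
Proof.
(* Cauchy-Schwarz bounds the dual norm of [f x] by [|x|], hence the constant 1. *)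
exists 1 => x; rewrite mul1r; apply: ge_sup.
  by exists `|f x 0|, 0 => //=; rewrite normr0.
move=> _ [y /= y1 <-]; rewrite (le_trans (ip_cauchy_schwarz _ _))//.
by rewrite ler_piMr.
Qed.

Lemma ip_operator : exists2 T : {linear X -> dual X}, bounded_operator T &
  forall x y : X, orth_op T x y <-> birkhoff_james x y.
Proof.
pose T : {linear X -> dual X} := HB.pack ip_dual
  (GRing.isLinear.Build R X (dual X) _ ip_dual ip_dual_linear).
exists T; first exact: ip_dual_bounded.
by move=> x y; split=> [/ip_birkhoff_james|/ip_birkhoff_james].
Qed.

(** Gram-Schmidt: [w] is [e2] minus its projection on [e1], and independence keeps both vectors
    nonzero before normalisation. *)
Lemma ip_orthonormal_pair (e1 e2 : X) :
  (forall a b : R, a *: e1 + b *: e2 = 0 -> a = 0 /\ b = 0) ->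
  exists u v, [/\ `|u| = 1, `|v| = 1 & f u v = 0].
Proof.
move=> ind.
have e1n0 : e1 != 0.
  apply/eqP => e10; have [] := ind 1 0; last by move/eqP; rewrite oner_eq0.
  by rewrite e10 scaler0 scale0r addr0.
pose w := (- (f e1 e2 / `|e1| ^+ 2)) *: e1 + e2.
have wn0 : w != 0.
  apply/eqP => w0; have [] := ind (- (f e1 e2 / `|e1| ^+ 2)) 1.
    by rewrite scale1r.
  by move=> _ /eqP; rewrite oner_eq0.
have unit (x : X) : x != 0 -> `| `|x|^-1 *: x| = 1.
  by move=> x0; rewrite normrZ normfV normr_id mulVf// normr_eq0.
exists (`|e1|^-1 *: e1), (`|w|^-1 *: w); split; [exact: unit|exact: unit|].
rewrite ipZl ipZr ip_linr -f_norm mulNr divfK ?sqrf_eq0 ?normr_eq0//.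
by rewrite addNr !mulr0.
Qed.

Lemma ip_norm_coord (u v : X) (a b : R) : `|u| = 1 -> `|v| = 1 -> f u v = 0 ->
  `|a *: u + b *: v| ^+ 2 = a ^+ 2 + b ^+ 2.
Proof.
move=> u1 v1 uv; rewrite ip_normD ipZl uv normrZ u1 v1 mulr1 real_normK ?num_real//.
by ring.
Qed.

End InnerProduct.

Section Plane.
Variables (R : fieldType) (X : lmodType R) (dimX : Vector.axiom 2 X).

Lemma plane_indep_pair : exists e1 e2 : X,
  forall a b : R, a *: e1 + b *: e2 = 0 -> a = 0 /\ b = 0.
Proof.
have [v2r lin [r2v v2rK r2vK]] := dimX.
pose g : {linear X -> 'rV[R]_2} := HB.pack v2r (GRing.isLinear.Build R X 'rV[R]_2 _ v2r lin).
exists (r2v (delta_mx 0 0)), (r2v (delta_mx 0 1)) => a b /(congr1 g).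
rewrite linearD !linearZ linear0 /= !r2vK => /rowP h.
by have := h 0; have := h 1; rewrite !mxE /= !mulr0 !mulr1 addr0 add0r.
Qed.

Lemma plane_span (u v : X) :
  (forall a b : R, a *: u + b *: v = 0 -> a = 0 /\ b = 0) ->
  forall x, exists a b : R, x = a *: u + b *: v.
Proof.
move=> ind x; have [v2r lin bij] := dimX.
pose g : {linear X -> 'rV[R]_2} := HB.pack v2r (GRing.isLinear.Build R X 'rV[R]_2 _ v2r lin).
(* The height is written [1 + 1] so that a row of coefficients splits into its two entries. *)
pose M : 'M[R]_(1 + 1, 2) := col_mx (g u) (g v).
have mulM (w : 'rV[R]_(1 + 1)) :
    w *m M = g (lsubmx w 0 0 *: u + rsubmx w 0 0 *: v).
  rewrite -[w in LHS]hsubmxK mul_row_col linearD !linearZ /=.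
  by rewrite [lsubmx w in LHS]mx11_scalar [rsubmx w in LHS]mx11_scalar !mul_scalar_mx.
have : row_full M.
  (* [M] is square, so full row rank and full column rank are the same equation; the former is the
     independence of [u] and [v]. *)
  rewrite /row_full; apply: inj_row_free => w.
  rewrite mulM -(linear0 g) => /(bij_inj bij)/ind[l0 r0].
  rewrite -[w]hsubmxK [lsubmx w]mx11_scalar [rsubmx w]mx11_scalar l0 r0.
  by rewrite !raddf0 row_mx0.
move=> /(submx_full (g x))/submxP[w].
rewrite mulM => xE; rewrite (bij_inj bij xE).
by exists (lsubmx w 0 0), (rsubmx w 0 0).
Qed.

End Plane.

Lemma birkhoff_james_indep (R : realType) (X : normedModType R) (u v : X) :
  u != 0 -> v != 0 -> birkhoff_james u v ->
  forall a b : R, a *: u + b *: v = 0 -> a = 0 /\ b = 0.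
Proof.
move=> u0 v0 uv a b ab0.
have a0 : a = 0.
  (* With this scalar [u + (a^-1 * b) *: v] is 0, so orthogonality would force [|u| <= 0]. *)
  apply/eqP; apply: contraT => an0; have := uv (a^-1 * b).
  rewrite -scalerA -[u in X in _ <= X](scalerK an0) -scalerDr ab0 scaler0.
  by rewrite normr0 normr_le0 (negbTE u0).
split=> //; move: ab0; rewrite a0 scale0r add0r => /eqP.
by rewrite scaler_eq0 (negbTE v0) orbF => /eqP.
Qed.

Lemma reflection_invariant_norm (R : realType) (X : normedModType R) (u v : X) :
  `|u| = 1 ->
  (forall gamma delta kappa : R,
     `|(gamma + kappa * delta) *: u + (delta - kappa * gamma) *: v| =
     `|(gamma - kappa * delta) *: u + (delta + kappa * gamma) *: v|) ->
  forall a b : R, `|a *: u + b *: v| ^+ 2 = a ^+ 2 + b ^+ 2.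
Proof.
move=> u1 refl.
have circle (a b : R) : a ^+ 2 + b ^+ 2 = 1 -> `|a *: u + b *: v| = 1.
  (* At the point [- u] the axis vector used below vanishes, but there the norm is known
     directly. *)
  move=> ab1; have [aN1|an1] := eqVneq (1 + a) 0.
    have b0 : b = 0.
      by apply/eqP; rewrite -sqrf_eq0; apply/eqP; move: ab1; nra.
    have -> : a = -1 by lra.
    by rewrite b0 scale0r addr0 scaleN1r normrN.
  (* The line through [u + (a *: u + b *: v)] is the axis of the reflection
     exchanging [u] and [a *: u + b *: v]. *)
  have := refl ((1 + a) / 2) (b / 2) (b / (1 + a)).
  (* These products make the left coefficients 1 and 0 and the right ones [a] and [b]. *)
  have kd : b / (1 + a) * (b / 2) = (1 - a) / 2.
    have b2 : b ^+ 2 = (1 - a) * (1 + a) by lra.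
    have -> : b / (1 + a) * (b / 2) = b ^+ 2 / ((1 + a) * 2) by field.
    by rewrite b2; field.
  have kg : b / (1 + a) * ((1 + a) / 2) = b / 2 by field.
  rewrite kd kg (_ : (1 + a) / 2 + (1 - a) / 2 = 1); last by field.
  rewrite (_ : (1 + a) / 2 - (1 - a) / 2 = a); last by field.
  by rewrite subrr scale0r addr0 scale1r u1 -splitr.
move=> a b; have s0 : 0 <= a ^+ 2 + b ^+ 2 by rewrite addr_ge0 ?sqr_ge0.
(* Homogeneity carries the result from the unit circle to the plane; the origin is separate because
   of the division by [r]. *)
set r := Num.sqrt (a ^+ 2 + b ^+ 2).
have rE : r ^+ 2 = a ^+ 2 + b ^+ 2 by rewrite sqr_sqrtr.
have [r0|rn0] := eqVneq r 0.
  move: rE; rewrite r0 expr0n /= => /esym/eqP.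
  rewrite paddr_eq0 ?sqr_ge0// !sqrf_eq0 => /andP[/eqP-> /eqP->].
  by rewrite !scale0r addr0 normr0 !expr0n /= addr0.
have /circle h : (a / r) ^+ 2 + (b / r) ^+ 2 = 1.
  by rewrite !expr_div_n -mulrDl -rE divff// sqrf_eq0.
have -> : a *: u + b *: v = r *: ((a / r) *: u + (b / r) *: v).
  by rewrite scalerDr !scalerA ![r * _]mulrC !divfK.
by rewrite normrZ h mulr1 real_normK ?num_real// rE.
Qed.

(** Polarisation of the norm yields the standard dot product of the coordinates, which is
    bilinear. *)
Lemma is_hilbert_coord (R : realType) (X : normedModType R) (u v : X) :
  (forall x, exists a b : R, x = a *: u + b *: v) ->
  (forall a b : R, `|a *: u + b *: v| ^+ 2 = a ^+ 2 + b ^+ 2) ->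
  is_hilbert X.
Proof.
move=> span nE; apply/is_hilbertP.
pose f (x y : X) : R := (`|x + y| ^+ 2 - `|x - y| ^+ 2) / 4.
have fE a b c d : f (a *: u + b *: v) (c *: u + d *: v) = a * c + b * d.
  by rewrite /f opprD !(addrACA (a *: u) (b *: v)) -!scalerBl -!scalerDl !nE; field.
exists f; split=> [x y|y a x z|x].
- by rewrite /f [y + x]addrC [`|y - x|]distrC.
- have [b [c ->]] := span x; have [d [e ->]] := span y; have [g [h ->]] := span z.
  by rewrite scalerDr !scalerA addrACA -!scalerDl !fE; ring.
- by have [a [b ->]] := span x; rewrite fE nE !expr2.
Qed.

Unset Implicit Arguments.
Set Strict Implicit.

Theorem theorem2p20 (R : realType) (X : completeNormedModType R)
    (dimX : Vector.axiom 2 X) :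
  is_hilbert X <->
  (exists2 T : {linear X -> dual X}, bounded_operator T &
     forall x y : X, orth_op T x y <-> birkhoff_james x y) /\
  (exists u v : X,
     [/\ `|u| = 1 /\ `|v| = 1, birkhoff_james u v, birkhoff_james v u,
         birkhoff_james (u + v) (u - v) &
         forall gamma delta kappa : R,
           `|(gamma + kappa * delta) *: u + (delta - kappa * gamma) *: v| =
           `|(gamma - kappa * delta) *: u + (delta + kappa * gamma) *: v|]).
Proof.
split=> [/is_hilbertP[f [fC fl fn]]|[_ [u [v [[u1 v1] uv _ _ refl]]]]].
  split; first exact: (ip_operator fC fl fn).
  have [e1 [e2 ind]] := plane_indep_pair dimX.
  have [u [v [u1 v1 uv]]] := ip_orthonormal_pair fC fl fn ind.
  have coord a b := ip_norm_coord fC fl fn a b u1 v1 uv.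
  have bj x y := ip_birkhoff_james fC fl fn x y.
  exists u, v; split=> //.
  - exact/bj.
  - by apply/bj; rewrite fC.
  (* The form at [u + v] and [u - v] equals [|u| ^+ 2 - |v| ^+ 2], which is 0. *)
  - apply/bj; rewrite -[u in u + v]scale1r fl -[u - v]addrC -scaleN1r.
    by rewrite !(ip_linr fC fl) (fC v u) uv -!fn u1 v1; ring.
  (* Both squared norms equal [(g ^+ 2 + d ^+ 2) * (1 + k ^+ 2)]. *)
  - move=> g d k; apply/eqP; rewrite -(@eqrXn2 _ 2)// !coord; apply/eqP; ring.
apply: (@is_hilbert_coord R X u v); last exact: reflection_invariant_norm.
by apply: (plane_span dimX); apply: birkhoff_james_indep => //;
   rewrite -normr_gt0 ?u1 ?v1.
Qed.
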